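(* There is a universal constant $K>0$ such that the following holds. Let $N,d,C\in\mathbb{N}$ with $N\ge 2$, let $r\ge 1$ and $0<\delta\le 1$, and let $(\mathbf{x}_1,y_1),\dots,(\mathbf{x}_N,y_N)\in\mathbb{R}^d\times\{1,\dots,C\}$ be a set of $N$ labeled samples with $\|\mathbf{x}_i\|\le r$ for every $i$ and $\|\mathbf{x}_i-\mathbf{x}_j\|\ge\delta$ for every $i\ne j$. Denote $R:=10rN^2\delta^{-1}\sqrt{\pi d}$. Then there exists a ReLU neural network $F:\mathbb{R}^d\to\mathbb{R}$ with width $12$ and depth at most $$K\left(\sqrt{N\log(N)}+\sqrt{\frac{N}{\log(N)}}\cdot\max\{\log(R),\log(C)\}\right)$$ such that $F(\mathbf{x}_i)=y_i$ for every $i\in\{1,\dots,N\}$.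
   Context: $\|\cdot\|$ is the Euclidean norm and $\log$ is the base-2 logarithm. $\sigma(z)=\max\{0,z\}$ is the ReLU function, applied coordinatewise to vectors. A ReLU neural network of depth $L$ is a function $\mathcal{N}:\mathbb{R}^d\to\mathbb{R}$ computed by $\mathbf{h}^{(1)}=\sigma(W^{(1)}\mathbf{x}+\mathbf{b}^{(1)})$ with $W^{(1)}\in\mathbb{R}^{m_1\times d}$, $\mathbf{b}^{(1)}\in\mathbb{R}^{m_1}$; $\mathbf{h}^{(i)}=\sigma(W^{(i)}\mathbf{h}^{(i-1)}+\mathbf{b}^{(i)})$ with $W^{(i)}\in\mathbb{R}^{m_i\times m_{i-1}}$, $\mathbf{b}^{(i)}\in\mathbb{R}^{m_i}$ for $i=2,\dots,L-1$; and $\mathcal{N}(\mathbf{x})=W^{(L)}\mathbf{h}^{(L-1)}+\mathbf{b}^{(L)}$ with $W^{(L)}\in\mathbb{R}^{1\times m_{L-1}}$, $\mathbf{b}^{(L)}\in\mathbb{R}$. Its width is $\max\{m_1,\dots,m_{L-1}\}$. *)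

(* Defs.v *)
From mathcomp Require Import all_boot all_order all_algebra.
From mathcomp Require Import all_classical all_reals all_analysis.

Set Implicit Arguments.
Unset Strict Implicit.
Unset Printing Implicit Defensive.

Import Order.TTheory GRing.Theory Num.Theory.
Local Open Scope ring_scope.

(* The canonical norm of matrices is the sup norm, hence this definition. *)
Definition norm2 (R : realType) (d : nat) (x : 'cV[R]_d) : R :=
  Num.sqrt (\sum_(i < d) x i 0 ^+ 2).

Definition log2 (R : realType) (z : R) : R := ln z / ln 2.

Definition relu (R : realType) (m : nat) (v : 'cV[R]_m) : 'cV[R]_m :=
  map_mx (fun z => Num.max 0 z) v.

(* [hidden_layers R d m] is the nonempty sequence of hidden layers (weights and
   biases) of a network with input dimension d whose last hidden layer has
   dimension m. *)
Inductive hidden_layers (R : realType) (d : nat) : nat -> Type :=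
| FirstLayer (m : nat) (W : 'M[R]_(m, d)) (b : 'cV[R]_m) : hidden_layers R d m
| NextLayer (m n : nat) (H : hidden_layers R d m)
    (W : 'M[R]_(n, m)) (b : 'cV[R]_n) : hidden_layers R d n.

Fixpoint hidden_eval (R : realType) (d m : nat) (H : hidden_layers R d m)
    (x : 'cV[R]_d) : 'cV[R]_m :=
  match H with
  | FirstLayer _ W b => relu (W *m x + b)
  | NextLayer _ _ H' W b => relu (W *m hidden_eval H' x + b)
  end.

Fixpoint hidden_count (R : realType) (d m : nat) (H : hidden_layers R d m) :
    nat :=
  match H with
  | FirstLayer _ _ _ => 1%N
  | NextLayer _ _ H' _ _ => (hidden_count H').+1
  end.

Fixpoint hidden_width (R : realType) (d m : nat) (H : hidden_layers R d m) :
    nat :=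
  match H with
  | FirstLayer m1 _ _ => m1
  | NextLayer _ n H' _ _ => maxn (hidden_width H') n
  end.

Record relu_network (R : realType) (d : nat) := ReluNetwork {
  last_dim : nat;
  hidden : hidden_layers R d last_dim;
  out_weight : 'M[R]_(1, last_dim);
  out_bias : R
}.

Definition net_eval (R : realType) (d : nat) (F : relu_network R d)
    (x : 'cV[R]_d) : R :=
  (out_weight F *m hidden_eval (hidden F) x) 0 0 + out_bias F.

(* The affine output layer counts: a depth-L network has L - 1 hidden layers. *)
Definition net_depth (R : realType) (d : nat) (F : relu_network R d) : nat :=
  (hidden_count (hidden F)).+1.

Definition net_width (R : realType) (d : nat) (F : relu_network R d) : nat :=
  hidden_width (hidden F).

(* Main.v *)
(** Project the samples to a line by a vector u with integer entries in [0, N^2]: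
    for each pair (i, j), some coordinate of x_i - x_j is at least delta / d, so
    fixing the other entries of u leaves at most one bad value of that entry, and
    N^2 + 1 possible values are enough to avoid all pairs. After rescaling, the
    projections t_i lie in [0, rho^4] and differ by at least 2, so their integer
    parts are distinct; these fingerprints and the labels fit in l bits, where
    l = O(max (log rho, log C)).
    Sort the samples and cut them into N / m groups of m = O(sqrt (N / log N))
    consecutive ones. The first half of the network is a piecewise constant function
    of t that loads, at two layers per group, the integers packing the m fingerprints
    and the m labels of the group of t. The second half unpacks these integers bit by
    bit, at two layers per bit, and adds up the label whose fingerprint matches t. *)

Require Import Defs.
From mathcomp Require Import all_boot all_order all_algebra.
From mathcomp Require Import all_classical all_reals all_analysis.
From mathcomp Require Import ring lra.
From mathcomp Require Import zify.

Set Implicit Arguments.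
Unset Strict Implicit.
Unset Printing Implicit Defensive.

Import Order.TTheory GRing.Theory Num.Theory.
Local Open Scope ring_scope.

(** * Networks of width 12 as sequences of register lists *)

(* A list of at most 12 registers stands for the values of the 12 neurons of a layer,
   as functions of the sample; missing registers are 0. *)
Definition affine_in {R : realType} {T : Type} (S : seq (T -> R)) (f : T -> R) : Prop :=
  exists (w : 'I_12 -> R) (b : R),
    forall i, f i = \sum_(j < 12) w j * nth (fun=> 0) S j i + b.

Fixpoint relu_layer {R : realType} {T : Type} (S S' : seq (T -> R)) : Prop :=
  if S' is g :: S'' then
    (exists2 f, affine_in S f & forall i, g i = Num.max 0 (f i)) /\ relu_layer S S''
  else True.

(** Only the values at the samples [x i] are recorded, so a layer may rely on facts that hold at the
    samples alone, such as the integrality of a register. *)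
Definition reach {R : realType} {T : Type} {d : nat} (x : T -> 'cV[R]_d) (k : nat)
    (S : seq (T -> R)) : Prop :=
  exists H : hidden_layers R d 12,
    [/\ hidden_count H = k, hidden_width H = 12%N &
        forall i, hidden_eval H (x i) = \col_j nth (fun=> 0) S j i].

Section Registers.
Context {R : realType} {T : Type}.
Implicit Types (S : seq (T -> R)) (f g : T -> R).

Lemma affine_cst S (b : R) : affine_in S (fun=> b).
Proof.
exists (fun=> 0), b => i; rewrite big1 ?add0r // => j _; exact: mul0r.
Qed.

Lemma affine_reg S (j : nat) : (j < 12)%N -> affine_in S (nth (fun=> 0) S j).
Proof.
move=> lt_j; exists (fun j' => (j' == Ordinal lt_j)%:R), 0 => i.
rewrite (bigD1 (Ordinal lt_j)) //= eqxx mul1r big1 ?addr0 // => j' /negbTE ->.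
exact: mul0r.
Qed.

Lemma affine_add S f g :
  affine_in S f -> affine_in S g -> affine_in S (fun i => f i + g i).
Proof.
move=> [w [b fE]] [w' [b' gE]]; exists (fun j => w j + w' j), (b + b') => i.
rewrite fE gE addrACA -big_split /=; congr (_ + _).
by apply: eq_bigr => j _; rewrite mulrDl.
Qed.

Lemma affine_scale S (a : R) f : affine_in S f -> affine_in S (fun i => a * f i).
Proof.
move=> [w [b fE]]; exists (fun j => a * w j), (a * b) => i.
rewrite fE mulrDr mulr_sumr; congr (_ + _).
by apply: eq_bigr => j _; rewrite mulrA.
Qed.

Lemma affine_opp S f : affine_in S f -> affine_in S (fun i => - f i).
Proof.
move=> /(affine_scale (-1)) [w [b fE]]; exists w, b => i.
by rewrite -fE mulN1r.
Qed.

Lemma relu_layerP S S' : relu_layer S S' -> forall j, (j < 12)%N ->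
  exists2 f, affine_in S f & forall i, nth (fun=> 0) S' j i = Num.max 0 (f i).
Proof.
elim: S' => [_ j _|g S' IH /= [Hg HS'] [//|j] ltj]; last by apply: IH => //; exact: ltnW.
exists (fun=> 0); first exact: affine_cst.
by move=> i; rewrite nth_nil maxxx.
Qed.

Context {d : nat} (x : T -> 'cV[R]_d).

Lemma reach_init (u : 'rV[R]_d) (b : R) :
  reach x 1 [:: fun i => Num.max 0 ((u *m x i) 0 0 + b)].
Proof.
exists (FirstLayer (\matrix_(j < 12, l < d) if j == 0 :> nat then u 0 l else 0)
                   (\col_(j < 12) if j == 0 :> nat then b else 0)).
split=> // i; apply/matrixP => j l; rewrite (ord1 l) /relu !mxE.
case: j => [[|j] ltj] /=; last first.
  rewrite big1 ?addr0 ?maxxx ?nth_nil // => l' _; rewrite !mxE /=.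
  exact: mul0r.
by rewrite mxE; congr (Num.max 0 (_ + _)); apply: eq_bigr => l' _; rewrite !mxE.
Qed.

Lemma reach_step (k : nat) S S' : reach x k S -> relu_layer S S' -> reach x k.+1 S'.
Proof.
move=> [H [Hk Hw HE]] /relu_layerP HS'.
have /choice [wb wbE] : forall j : 'I_12, exists wb : ('I_12 -> R) * R, forall i,
    nth (fun=> 0) S' j i = Num.max 0 (\sum_(l < 12) wb.1 l * nth (fun=> 0) S l i + wb.2).
  move=> j; have [f [w [b fE]] S'E] := HS' j (ltn_ord j).
  by exists (w, b) => i; rewrite S'E fE.
exists (NextLayer H (\matrix_(j < 12, l < 12) (wb j).1 l) (\col_j (wb j).2)).
split=> [|/=|i /=]; [by rewrite /= Hk | by rewrite Hw |].
apply/matrixP => j l; rewrite HE (ord1 l) /relu !mxE wbE.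
by congr (Num.max 0 (_ + _)); apply: eq_bigr => l' _; rewrite !mxE.
Qed.

Lemma reach_network (k : nat) S (j : nat) : (j < 12)%N -> reach x k S ->
  exists F : relu_network R d, [/\ net_width F = 12%N, net_depth F = k.+1 &
    forall i, net_eval F (x i) = nth (fun=> 0) S j i].
Proof.
move=> ltj [H [Hk Hw HE]].
exists (ReluNetwork H (\row_l (l == Ordinal ltj)%:R) 0); split=> // [|i].
  by rewrite /net_depth Hk.
rewrite /net_eval /= HE !mxE addr0 (bigD1 (Ordinal ltj)) //= !mxE eqxx mul1r.
by rewrite big1 ?addr0 // => l /negbTE; rewrite !mxE => ->; rewrite mul0r.
Qed.

End Registers.

(** Registers 0 to 9 are enough: no layer below fills more than ten. *)
Ltac affine :=
  match goal with
  | |- affine_in _ (fun=> ?b) => exact: affine_cst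
  | |- affine_in _ (fun i => _ + _) => apply: affine_add; affine
  | |- affine_in _ (fun i => - _) => apply: affine_opp; affine
  | |- affine_in _ (fun i => _ * _) => apply: affine_scale; affine
  | |- _ => first [exact: (@affine_reg _ _ _ 0) | exact: (@affine_reg _ _ _ 1)
      | exact: (@affine_reg _ _ _ 2) | exact: (@affine_reg _ _ _ 3) | exact: (@affine_reg _ _ _ 4)
      | exact: (@affine_reg _ _ _ 5) | exact: (@affine_reg _ _ _ 6) | exact: (@affine_reg _ _ _ 7)
      | exact: (@affine_reg _ _ _ 8) | exact: (@affine_reg _ _ _ 9)]
  end.

(** * Bit extraction, slot decoding and group loading *)

Section BitDecoding.
Context {R : realType} {T : Type} {d : nat} (x : T -> 'cV[R]_d).
Implicit Types (t out : T -> R) (u v w a : T -> nat).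

(** Carries a value unchanged to the next layer, since ReLU fixes nonnegative numbers; hence the
    sign hypotheses on [t] and [out] below. *)
Lemma relu_keep (S : seq (T -> R)) (f : T -> R) :
  affine_in S f -> (forall i, 0 <= f i) ->
  exists2 g, affine_in S g & forall i, f i = Num.max 0 (g i).
Proof. by move=> Sf f0; exists f => // i; rewrite max_r. Qed.

Lemma relu_of (S : seq (T -> R)) (f : T -> R) : affine_in S f ->
  exists2 g, affine_in S g & forall i, Num.max 0 (f i) = Num.max 0 (g i).
Proof. by exists f. Qed.

(** A ramp of length 1 between consecutive integers is an exact step function on the integers, so
    two ReLUs compare without error. *)
Lemma relu_threshold (n c : nat) :
  Num.max 0 (n%:R - c%:R + 1) - Num.max 0 (n%:R - c%:R) = (c <= n)%N%:R :> R.
Proof.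
have [le_cn|lt_nc] := leqP c n.
  have H : (c%:R <= n%:R :> R) by rewrite ler_nat.
  rewrite !max_r /=; lra.
have H : (n%:R + 1 <= c%:R :> R) by rewrite natr1 ler_nat.
rewrite !max_l /=; lra.
Qed.

(** Induction on [l], one leading bit of [v] and of [v'] per round. A first layer computes the ramps
    that detect the bit; a second one removes it from the packed integer and adds it, with its
    weight, to the accumulator. *)
Lemma extract_bits (k l e : nat) t out v v' w w' a a' :
  (forall i, 0 <= t i) -> (forall i, 0 <= out i) ->
  (forall i, (v i < 2 ^ l)%N) -> (forall i, (v' i < 2 ^ l)%N) ->
  (forall i, (w i < 2 ^ e)%N) -> (forall i, (w' i < 2 ^ e)%N) ->
  reach x k [:: t; out; fun i => (v i * 2 ^ e + w i)%:R;
    fun i => (v' i * 2 ^ e + w' i)%:R; fun i => (a i)%:R; fun i => (a' i)%:R] ->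
  reach x (k + 2 * l) [:: t; out; fun i => (w i)%:R; fun i => (w' i)%:R;
    fun i => (a i + v i)%:R; fun i => (a' i + v' i)%:R].
Proof.
move=> t0 out0; elim: l => [|l IH] in k v v' a a' *.
  move=> v1 v'1 _ _; rewrite muln0 addn0; congr (reach x k).
  have vE i : v i = 0%N by have := v1 i; lia.
  have v'E i : v' i = 0%N by have := v'1 i; lia.
  by congr [:: _; _; _; _; _; _]; apply/funext => i; rewrite ?vE ?v'E ?addn0.
move=> vl v'l we w'e HS.
pose U i := (v i * 2 ^ e + w i)%N; pose U' i := (v' i * 2 ^ e + w' i)%N.
(* The weight of the leading bit of [v] inside [U]; as [w i < 2 ^ e], the test [c <= U i] reads
   exactly this bit. *)
pose c := (2 ^ (l + e))%N.
have {}HS : reach x k.+1 [:: t; out; fun i => (U i)%:R;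
    fun i => (U' i)%:R; fun i => (a i)%:R; fun i => (a' i)%:R;
    fun i => Num.max 0 ((U i)%:R - c%:R + 1); fun i => Num.max 0 ((U i)%:R - c%:R);
    fun i => Num.max 0 ((U' i)%:R - c%:R + 1); fun i => Num.max 0 ((U' i)%:R - c%:R)].
  apply: (reach_step HS); repeat split;
    solve [apply: relu_keep => //; affine | apply: relu_of; affine].
pose b (v0 : T -> nat) i : nat := (2 ^ l <= v0 i)%N.
have divb v0 i : (v0 i < 2 ^ l.+1)%N -> (v0 i = b v0 i * 2 ^ l + v0 i %% 2 ^ l)%N.
  rewrite /b expnS => lt; have [le|gt] := leqP (2 ^ l) (v0 i); last by rewrite modn_small.
  have -> : v0 i = (v0 i - 2 ^ l + 2 ^ l)%N by rewrite subnK.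
  rewrite modnDr modn_small; lia.
have cE v0 w0 i : (w0 i < 2 ^ e)%N ->
    (c <= v0 i * 2 ^ e + w0 i)%N = (2 ^ l <= v0 i)%N.
  move=> lt; rewrite /c expnD; apply/idP/idP; last by nia.
  by apply: contraTT; rewrite -!ltnNge => lt'; nia.
have HS' : reach x k.+2 [:: t; out; fun i => (v i %% 2 ^ l * 2 ^ e + w i)%:R;
    fun i => (v' i %% 2 ^ l * 2 ^ e + w' i)%:R; fun i => (a i + b v i * 2 ^ l)%:R;
    fun i => (a' i + b v' i * 2 ^ l)%:R].
  apply: (reach_step HS); repeat split.
  - by apply: relu_keep => //; affine.
  - by apply: relu_keep => //; affine.
  - exists (fun i => (U i)%:R - c%:R * (Num.max 0 ((U i)%:R - c%:R + 1) - Num.max 0 ((U i)%:R - c%:R))).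
      by affine.
    move=> i; rewrite relu_threshold /U cE // -/(b v i) {2}(divb v i (vl i)).
    rewrite [X in Num.max 0 X](_ : _ = (v i %% 2 ^ l * 2 ^ e + w i)%:R) ?max_r //.
    rewrite /c expnD !(natrD, natrM); ring.
  - exists (fun i => (U' i)%:R - c%:R * (Num.max 0 ((U' i)%:R - c%:R + 1) - Num.max 0 ((U' i)%:R - c%:R))).
      by affine.
    move=> i; rewrite relu_threshold /U' cE // -/(b v' i) {2}(divb v' i (v'l i)).
    rewrite [X in Num.max 0 X](_ : _ = (v' i %% 2 ^ l * 2 ^ e + w' i)%:R) ?max_r //.
    rewrite /c expnD !(natrD, natrM); ring.
  - exists (fun i => (a i)%:R + (2 ^ l)%:R * (Num.max 0 ((U i)%:R - c%:R + 1) - Num.max 0 ((U i)%:R - c%:R))).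
      by affine.
    move=> i; rewrite relu_threshold /U cE // -/(b v i).
    by rewrite -natrM -natrD max_r // mulnC.
  - exists (fun i => (a' i)%:R + (2 ^ l)%:R * (Num.max 0 ((U' i)%:R - c%:R + 1) - Num.max 0 ((U' i)%:R - c%:R))).
      by affine.
    move=> i; rewrite relu_threshold /U' cE // -/(b v' i).
    by rewrite -natrM -natrD max_r // mulnC.
have := IH k.+2 (fun i => v i %% 2 ^ l)%N (fun i => v' i %% 2 ^ l)%N
  (fun i => a i + b v i * 2 ^ l)%N (fun i => a' i + b v' i * 2 ^ l)%N.
move=> /(_ _ _ we w'e HS'); rewrite mulnS addnA addn2.
have -> : (fun i => (a i + b v i * 2 ^ l + v i %% 2 ^ l)%:R : R) = (fun i => (a i + v i)%:R).
  by apply/funext => i; rewrite -addnA -divb.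
have -> : (fun i => (a' i + b v' i * 2 ^ l + v' i %% 2 ^ l)%:R : R) = (fun i => (a' i + v' i)%:R).
  by apply/funext => i; rewrite -addnA -divb.
by apply=> i; rewrite ltn_mod expn_gt0.
Qed.

(** Digits in base [2 ^ l], with index 0 leading because bits are extracted from the top. *)
Fixpoint pack (l m : nat) (f : nat -> nat) : nat :=
  if m is m'.+1 then f 0 * 2 ^ (l * m') + pack l m' (f \o succn) else 0.

Lemma pack_lt (l m : nat) (f : nat -> nat) :
  (forall p, f p < 2 ^ l)%N -> (pack l m f < 2 ^ (l * m))%N.
Proof.
elim: m f => [|m IH] f fl; first by rewrite muln0.
rewrite /= mulnS expnD; apply: (@leq_trans ((f 0).+1 * 2 ^ (l * m))).
  by rewrite mulSn [(_ + pack _ _ _)%N]addnC ltn_add2r IH // => p; exact: fl.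
by rewrite leq_mul2r fl orbT.
Qed.

(* If s is in [X, X + 1] the subtracted term vanishes and the label Y comes out; if s is
   outside ]X - 1, X + 2[, the term is at least c, which cancels every label Y <= c. *)
Definition slot_output (c s : R) (X Y : nat) : R :=
  Num.max 0 (Y%:R - c * (Num.max 0 (X%:R - s) + Num.max 0 (s - X%:R - 1))).

(** A slot takes [2 * l] layers to extract its fingerprint and label, and three more: the one-sided
    distances from [t] to the fingerprint interval, the slot output, and its addition to [out],
    which also resets the accumulators. *)
Lemma decode_slots (k l m : nat) (c : R) t out (f h : T -> nat -> nat) :
  (forall i, 0 <= t i) -> (forall i, 0 <= out i) ->
  (forall i p, f i p < 2 ^ l)%N -> (forall i p, h i p < 2 ^ l)%N ->
  reach x k [:: t; out; fun i => (pack l m (f i))%:R; fun i => (pack l m (h i))%:R;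
    fun=> 0%:R; fun=> 0%:R] ->
  exists S, reach x (k + m * (2 * l + 3))
    (t :: (fun i => out i + \sum_(p < m) slot_output c (t i) (f i p) (h i p)) :: S).
Proof.
move=> t0; elim: m => [|m IH] in k out f h *.
  move=> out0 fl hl HS; rewrite mul0n addn0.
  exists [:: fun i => (pack l 0 (f i))%:R; fun i => (pack l 0 (h i))%:R; fun=> 0%:R; fun=> 0%:R].
  by under [X in reach _ _ (_ :: X :: _)]eq_fun do rewrite big_ord0 addr0.
move=> out0 fl hl /= HS.
have {HS} := extract_bits t0 out0 (fl^~ 0%N) (hl^~ 0%N)
  (fun i => pack_lt m (fun p => fl i p.+1)) (fun i => pack_lt m (fun p => hl i p.+1)) HS.
set U := fun i => _%:R; set W := fun i => _%:R => HS.
pose e1 i : R := Num.max 0 ((0 + f i 0)%:R - t i).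
pose e2 i : R := Num.max 0 (t i - (0 + f i 0)%:R - 1).
have {}HS : reach x (k + 2 * l).+1
    [:: t; out; U; W; fun i => (0 + h i 0)%:R; e1; e2].
  apply: (reach_step HS); repeat split;
    solve [apply: relu_keep => //; affine | apply: relu_of; affine].
pose z i := Num.max 0 ((0 + h i 0)%:R - c * (e1 i + e2 i)).
have {}HS : reach x (k + 2 * l).+2 [:: t; out; U; W; z].
  apply: (reach_step HS); repeat split;
    solve [apply: relu_keep => //; affine | apply: relu_of; affine].
have z0 i : 0 <= z i by rewrite le_max lexx.
have {}HS : reach x (k + 2 * l).+3
    [:: t; fun i => out i + z i; U; W; fun=> 0%:R; fun=> 0%:R].
  apply: (reach_step HS); repeat split;
    by apply: relu_keep => [|i]; rewrite ?addr_ge0 //; affine.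
have [|||S HS'] := IH _ (fun i => out i + z i) (fun i => f i \o succn) (fun i => h i \o succn) _ _ _ HS.
- by move=> i; rewrite addr_ge0.
- by move=> i p; exact: fl.
- by move=> i p; exact: hl.
exists S; rewrite mulSn addnA [(k + (2 * l + 3))%N]addnA addn3.
move: HS'; congr (reach _ _ (_ :: _ :: _)); apply/funext => i.
by rewrite big_ord_recl addrA.
Qed.

(** No [t i] lies strictly between [cut j] and [cut j + 1], so a unit ramp there tests [j <= g i]
    exactly at every sample. Adding the increments [u n.+1 - u n], possibly negative, under these
    tests telescopes. *)
Lemma select_group (k : nat) t (g : T -> nat) (cut : nat -> R) (u v : nat -> nat) :
  (forall i, 0 <= t i) ->
  (forall i j, (g i < j)%N -> t i <= cut j) ->
  (forall i j, (j <= g i)%N -> cut j + 1 <= t i) ->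
  reach x k [:: t] -> forall n,
  reach x (k + 2 * n).+1 [:: t; fun=> 0; fun i => (u (minn (g i) n))%:R;
    fun i => (v (minn (g i) n))%:R; fun=> 0%:R; fun=> 0%:R].
Proof.
move=> t0 cut_gt cut_le Ht; elim=> [|n HS].
  rewrite muln0 addn0; apply: (reach_step Ht); repeat split;
    try by apply: relu_keep => //; affine.
  - exists (fun=> (u 0)%:R); first by affine.
    by move=> i; rewrite minn0 max_r.
  - exists (fun=> (v 0)%:R); first by affine.
    by move=> i; rewrite minn0 max_r.
pose p i := Num.max 0 (t i - cut n.+1); pose q i := Num.max 0 (t i - cut n.+1 - 1).
have pqE i : p i - q i = (n < g i)%N%:R.
  rewrite /p /q; have [le|gt] := ltnP n (g i).
    have := cut_le i n.+1 le => H; rewrite !max_r /=; lra.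
  have H : t i <= cut n.+1 by apply: cut_gt; rewrite ltnS.
  rewrite !max_l /=; lra.
have minE i : minn (g i) n.+1 = if (n < g i)%N then n.+1 else minn (g i) n.
  by case: ltnP; lia.
have minE' i : (n < g i)%N -> minn (g i) n = n by lia.
have {}HS := reach_step HS (S' := [:: t; fun=> 0; fun i => (u (minn (g i) n))%:R;
    fun i => (v (minn (g i) n))%:R; p; q]).
rewrite mulnS addnCA add2n; apply: (reach_step (HS _)); repeat split;
  try solve [apply: relu_keep => //; affine | apply: relu_of; affine].
- exists (fun i => (u (minn (g i) n))%:R + ((u n.+1)%:R - (u n)%:R) * (p i - q i)).
    by affine.
  move=> i; rewrite pqE minE; case: ifP => [lt|_]; last by rewrite mulr0 addr0 max_r.
  by rewrite minE' //= mulr1 addrC subrK max_r.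
- exists (fun i => (v (minn (g i) n))%:R + ((v n.+1)%:R - (v n)%:R) * (p i - q i)).
    by affine.
  move=> i; rewrite pqE minE; case: ifP => [lt|_]; last by rewrite mulr0 addr0 max_r.
  by rewrite minE' //= mulr1 addrC subrK max_r.
Qed.

End BitDecoding.

(** * Selectivity of the slot output *)

Section SlotOutput.
Context {R : realType}.
Implicit Types (c s : R) (X Y : nat).

Lemma slot_output_match c s Y : 0 <= s -> slot_output c s (Num.truncn s) Y = Y%:R.
Proof.
move=> /truncn_itv/andP[le_s]; rewrite -natr1 => lt_s.
rewrite /slot_output [Num.max 0 (_ - s)]max_l; last by lra.
rewrite [Num.max 0 (s - _ - 1)]max_l; last by lra.
by rewrite addr0 mulr0 subr0 max_r.
Qed.

(** From the gap 2, either the rounding of [s'] or the unit length of the matching interval takes at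
    most 1; the remaining distance, at least 1, makes the penalty at least [c]. *)
Lemma slot_output_far c s s' Y :
  Y%:R <= c -> 0 <= s' -> 2 <= `|s - s'| -> slot_output c s (Num.truncn s') Y = 0.
Proof.
move=> Yc /truncn_itv/andP[le_s]; rewrite -natr1 => lt_s far.
have c0 : 0 <= c by apply: le_trans Yc.
rewrite /slot_output max_l // subr_le0 (le_trans Yc) // ler_peMr //.
set e1 := Num.max 0 (_ - s); set e2 := Num.max 0 (s - _ - 1).
have e1_ge0 : 0 <= e1 by rewrite le_max lexx.
have e2_ge0 : 0 <= e2 by rewrite le_max lexx.
have e1_ge : (Num.truncn s')%:R - s <= e1 by rewrite le_max lexx orbT.
have e2_ge : s - (Num.truncn s')%:R - 1 <= e2 by rewrite le_max lexx orbT.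
by move: far; rewrite ler_normr => /orP[] far; lra.
Qed.

(** Serves the slots that no sample occupies, whose label is 0 by default. *)
Lemma slot_output0 c s X : 0 <= c -> slot_output c s X 0 = 0.
Proof.
move=> c0; rewrite /slot_output max_l // sub0r oppr_le0 mulr_ge0 // addr_ge0 //;
by rewrite le_max lexx.
Qed.

End SlotOutput.

(** * Memorization of separated points on a line *)

Lemma memorize_line (R : realType) (N d : nat) (x : 'I_N -> 'cV[R]_d) (t : 'I_N -> R)
    (y : 'I_N -> nat) (C l m : nat) :
  reach x 1 [:: t] -> (forall i, 0 <= t i) -> (forall i, t i < 2 ^+ l) ->
  (forall i j, i != j -> 2 <= `|t i - t j|) ->
  (forall i, (y i <= C)%N) -> (C < 2 ^ l)%N -> (0 < m)%N ->
  exists F : relu_network R d, [/\ net_width F = 12%N,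
    net_depth F = (2 * (N %/ m) + 3 + m * (2 * l + 3))%N &
    forall i, net_eval F (x i) = (y i)%:R].
Proof.
move=> Ht t0 tl sep yC Cl m0.
pose rank i := #|[set j | t j < t i]|.
have rank_le i j : t i <= t j -> (rank i <= rank j)%N.
  move=> le; apply/subset_leq_card/fintype.subsetP => j'; rewrite !inE => lt.
  exact: lt_le_trans le.
have rank_lt i j : (rank i < rank j)%N -> t i < t j.
  by apply: contraTT; rewrite -leNgt -leqNgt; exact: rank_le.
have rank_inj : injective rank.
  have lt_rank i j : t i < t j -> (rank i < rank j)%N.
    move=> lt; apply/proper_card/properP; split.
      by apply/fintype.subsetP => j'; rewrite !inE => /lt_trans; apply.
    by exists i; rewrite !inE ?ltxx.
  move=> i j; apply: contra_eq => /sep sep_ij.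
  have [/lt_rank|/lt_rank|eq_ij] := ltgtP (t i) (t j); [by rewrite neq_ltn => ->| |].
    by rewrite neq_ltn => ->; rewrite orbT.
  by move: sep_ij; rewrite eq_ij subrr normr0 lern0.
have rank_ltN i : (rank i < N)%N.
  rewrite -[X in (_ < X)%N]card_ord -cardsT; apply/proper_card/properP.
  by split; [exact: finset.subsetT | exists i; rewrite !inE ?ltxx].
(* The sample of rank [q] occupies slot [q %% m] of group [q %/ m]. *)
pose g i := (rank i %/ m)%N.
pose code (v : 'I_N -> nat) q := if [pick i | rank i == q] is Some i then v i else 0%N.
have codeE v i : code v (rank i) = v i.
  by rewrite /code; case: pickP => [j /eqP/rank_inj -> //|/(_ i)]; rewrite eqxx.
have code_lt v q : (forall i, v i < 2 ^ l)%N -> (code v q < 2 ^ l)%N.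
  by rewrite /code => vl; case: pickP => // _; rewrite expn_gt0.
(* The default -1 makes [cut j + 1 <= t i] follow from [0 <= t i] when no sample lies in a group
   below [j]; otherwise the separation by 2 gives it. *)
pose cut j : R := \big[Num.max/-1]_(i | (g i < j)%N) t i.
have cut_gt i j : (g i < j)%N -> t i <= cut j.
  by move=> lt; rewrite /cut; exact: le_bigmax_cond.
have cut_le i j : (j <= g i)%N -> cut j + 1 <= t i.
  move=> le; rewrite -lerBrDr; apply: bigmax_le => [|i' lt].
    by rewrite lerBrDr addNr.
  have ltr : t i' < t i.
    apply: rank_lt; rewrite ltnNge; apply/negP => /(leq_div2r m).
    by rewrite leqNgt (leq_trans lt le).
  have ne : i != i' by apply: contraTneq ltr => ->; rewrite ltxx.
  have := sep _ _ ne; rewrite gtr0_norm; lra.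
pose X i := Num.truncn (t i).
have Xl i : (X i < 2 ^ l)%N by rewrite truncn_lt_nat // natrX.
have yl i : (y i < 2 ^ l)%N by exact: leq_ltn_trans Cl.
pose group v i p := code v (g i * m + p)%N.
have HS := select_group (fun j => pack l m (fun p => code X (j * m + p)%N))
  (fun j => pack l m (fun p => code y (j * m + p)%N)) t0 cut_gt cut_le Ht (N %/ m).
have gE i : minn (g i) (N %/ m) = g i.
  by apply/minn_idPl; apply: leq_div2r; exact: ltnW.
have {}HS : reach x (1 + 2 * (N %/ m)).+1 [:: t; fun=> 0; fun i => (pack l m (group X i))%:R;
    fun i => (pack l m (group y i))%:R; fun=> 0%:R; fun=> 0%:R].
  by move: HS; congr (reach _ _ [:: _; _; _; _; _; _]); apply/funext => i; rewrite gE.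
have [S HS'] := decode_slots C%:R t0 (fun=> lexx 0) (fun i p => code_lt X _ Xl)
  (fun i p => code_lt y _ yl) HS.
have [F [Fw Fd FE]] := reach_network (j := 1) isT HS'.
exists F; split=> // [|i]; first by rewrite Fd; lia.
rewrite FE /= add0r (bigD1 (Ordinal (ltn_pmod (rank i) m0))) //=.
rewrite /group -divn_eq !codeE slot_output_match // big1 ?addr0 // => p ne_p.
(* Fingerprint and label of slot [p] come from the same [pick]: either both belong to one sample,
   which is not [i], or the slot is empty. *)
rewrite /code; case: pickP => [j /eqP rank_j|_]; last by rewrite slot_output0.
apply: slot_output_far => //; first by rewrite ler_nat.
apply: sep; apply: contra_neq ne_p => ij; apply/val_inj => /=.
by rewrite ij rank_j modnMDl modn_small.
Qed.

(** * Separating projections to a line *)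

Lemma separating_integer_vector (R : realType) (I : finType) (d M : nat)
    (z : I -> 'cV[R]_d) (e : R) :
  0 < e -> (#|I| < M)%N -> (forall i, exists l, e <= `|z i l 0|) ->
  exists u : 'I_d -> 'I_M, forall i, e / 2 <= `|\sum_l (u l)%:R * z i l 0|.
Proof.
move=> e0 IM /choice [k ke]; apply: contrapT => /forallNP no_u.
have /choice [b bE] : forall u : {ffun 'I_d -> 'I_M}, exists i,
    `|\sum_l (u l)%:R * z i l 0| < e / 2.
  move=> u; have /existsNP[i /negP] := no_u u.
  by rewrite -ltNge => lt; exists i.
(* If every u were bad for some sample b u, replacing the entry of u at the large
   coordinate of z (b u) would inject M^d * M pairs into #|I| * M^d. *)
pose change (ua : {ffun 'I_d -> 'I_M} * 'I_M) : I * {ffun 'I_d -> 'I_M} :=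
  (b ua.1, [ffun l => if l == k (b ua.1) then ua.2 else ua.1 l]).
have change_inj : injective change.
  move=> [u a] [u' a'] /= [b_eq /ffunP v_eq].
  have := v_eq (k (b u)); rewrite !ffunE -b_eq eqxx => ->; congr (_, _).
  have eq_off l : l != k (b u) -> u l = u' l.
    by move=> /negbTE ne; have := v_eq l; rewrite !ffunE -b_eq ne.
  apply/ffunP => l; have [->|] := eqVneq l (k (b u)); last exact: eq_off.
  have := bE u; have := bE u'; rewrite -b_eq.
  set i := b u; set j := k i => lt' lt.
  (* Both sums are below [e / 2] and differ only in the term [j], whereas distinct integers [u j]
     and [u' j] would make that difference at least [e]. *)
  have H : `|((u j)%:R - (u' j)%:R) * z i j 0| < e.
    have -> : ((u j)%:R - (u' j)%:R) * z i j 0 =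
        \sum_l (u l)%:R * z i l 0 - \sum_l (u' l)%:R * z i l 0.
      rewrite -sumrB (bigD1 j) //= big1 ?addr0 ?mulrBl // => l' ne.
      by rewrite eq_off // subrr.
    rewrite [e]splitr; apply: le_lt_trans (ler_normB _ _) _; exact: ltrD.
  apply/val_inj/eqP => /=; apply: contraTT H => ne; rewrite -leNgt normrM.
  apply: le_trans (ke i) _; rewrite ler_peMl //.
  rewrite ler_normr; move: ne; rewrite neq_ltn => /orP[];
    rewrite -(ler_nat R) -natr1 => lt1; apply/orP; [right|left]; lra.
have := leq_card change change_inj; rewrite !card_prod card_ord mulnC leq_pmul2r.
  by rewrite leqNgt IM.
by rewrite card_ffun !card_ord expn_gt0; apply/orP; left; exact: leq_ltn_trans IM.
Qed.

Lemma coord_le_norm2 (R : realType) (d : nat) (z : 'cV[R]_d) (l : 'I_d) :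
  `|z l 0| <= norm2 z.
Proof.
rewrite /norm2 -[`|_|]sqrtr_sqr ler_wsqrtr // (bigD1 l) //= lerDl.
by apply: sumr_ge0 => j _; exact: sqr_ge0.
Qed.

(** Otherwise the sum of squares is below [d * (e / d) ^ 2 = e ^ 2 / d], hence below [e ^ 2]. *)
Lemma exists_large_coord (R : realType) (d : nat) (z : 'cV[R]_d) (e : R) :
  0 < e -> e <= norm2 z -> exists l, e / d%:R <= `|z l 0|.
Proof.
move=> e0 ez; apply: contrapT => /forallNP small.
have {}small l : `|z l 0| < e / d%:R by rewrite ltNge; apply/negP.
have d0 : (0 < d)%N.
  case: d => // in z ez small *; move: ez.
  by rewrite /norm2 big_ord0 sqrtr0 leNgt e0.
have d1 : 1 <= d%:R :> R by rewrite ler1n.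
have e_pos : 0 <= e / d%:R by rewrite divr_ge0 // ltW.
move: ez; rewrite leNgt => /negP; apply.
have -> : e = Num.sqrt (e ^+ 2) by rewrite sqrtr_sqr gtr0_norm.
rewrite /norm2 ltr_sqrt ?exprn_gt0 //.
apply: (@lt_le_trans _ _ (\sum_(l < d) (e / d%:R) ^+ 2)).
  apply: ltr_sum => [|l _]; first by apply/hasP; exists (Ordinal d0); rewrite ?mem_index_enum.
  by rewrite -real_normK ?num_real // ltrXn2r // nnegrE.
rewrite sumr_const card_ord -[X in X <= _]mulr_natr expr_div_n -mulrA ler_piMr ?sqr_ge0 //.
by rewrite expr2 invfM -mulrA mulVf ?mulr1 ?invf_le1 // ?gt_eqF ?ltr0n.
Qed.

Lemma separating_projection (R : realType) (N d : nat) (r delta : R)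
    (x : 'I_N -> 'cV[R]_d) :
  0 < delta -> (forall i, norm2 (x i) <= r) ->
  (forall i j, i != j -> delta <= norm2 (x i - x j)) ->
  exists (u : 'rV[R]_d) (b : R),
    (forall i, 0 <= (u *m x i) 0 0 + b <= 8 * d%:R ^+ 2 * r * N%:R ^+ 2 / delta) /\
    (forall i j, i != j -> 2 <= `|(u *m x i) 0 0 - (u *m x j) 0 0|).
Proof.
move=> delta0 xr sep.
have [d0|d0] := posnP d.
  subst d; exists 0, 0; split=> [i|i j /sep].
    by rewrite mul0mx mxE addr0 expr0n /= !(mulr0, mul0r) lexx.
  by rewrite /norm2 big_ord0 sqrtr0 leNgt delta0.
have dR : 0 < d%:R :> R by rewrite ltr0n.
pose I := {p : 'I_N * 'I_N | p.1 != p.2}.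
pose z (p : I) := x (val p).1 - x (val p).2.
have IN : (#|{: I}| < (N ^ 2).+1)%N.
  by rewrite ltnS card_sig (leq_trans (max_card _)) // card_prod card_ord mulnn.
have [p|u uP] := separating_integer_vector (z := z) (divr_gt0 delta0 dR) IN.
  by apply: exists_large_coord => //; exact: sep (valP p).
(* The integer vector guarantees gaps of [delta / d / 2]; the factor [c] stretches them to 2. *)
pose c := 4 * d%:R / delta; pose s i := \sum_l (u l)%:R * x i l 0.
have c0 : 0 < c by rewrite /c divr_gt0 // mulr_gt0.
have uxE i : ((\row_l (c * (u l)%:R)) *m x i) 0 0 = c * s i.
  by rewrite !mxE mulr_sumr; apply: eq_bigr => l _; rewrite mxE mulrA.
have s_le i : `|s i| <= d%:R * (N%:R ^+ 2 * r).
  apply: le_trans (ler_norm_sum _ _ _) _.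
  rewrite mulrC mulr_natr -[X in _ *+ X]card_ord -sumr_const; apply: ler_sum => l _.
  rewrite normrM ler_pM // ?normr_nat -?natrX ?ler_nat -1?ltnS //.
  exact: le_trans (coord_le_norm2 _ _) (xr i).
(* The shift is the bound on the absolute value of [c * s i], so the projections become
   nonnegative. *)
exists (\row_l (c * (u l)%:R)), (c * (d%:R * (N%:R ^+ 2 * r))); split=> [i|i j ne].
  rewrite uxE -mulrDr; have := s_le i; rewrite ler_norml => /andP[H1 H2].
  apply/andP; split; first by rewrite mulr_ge0 ?(ltW c0) //; lra.
  have -> : 8 * d%:R ^+ 2 * r * N%:R ^+ 2 / delta = c * (2 * (d%:R * (N%:R ^+ 2 * r))).
    by rewrite /c; field; rewrite gt_eqF.
  by rewrite ler_pM2l //; lra.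
have := uP (exist _ (i, j) ne); rewrite !uxE -mulrBr normrM (gtr0_norm c0).
have -> : \sum_l (u l)%:R * z (exist _ (i, j) ne) l 0 = s i - s j.
  by rewrite -sumrB; apply: eq_bigr => l _; rewrite !mxE mulrBr.
move=> H; apply: le_trans (ler_wpM2l (ltW c0) H).
have -> // : c * (delta / d%:R / 2) = 2.
by rewrite /c; field; rewrite !gt_eqF.
Qed.

(** * Base-2 logarithms *)

Lemma ln2_gt0 (R : realType) : 0 < ln (2 : R).
Proof. by rewrite ln_gt0 // ltr1n. Qed.

Lemma log2X (R : realType) (n : nat) (z : R) :
  0 < z -> log2 (z ^+ n) = n%:R * log2 z.
Proof. by move=> z0; rewrite /log2 lnXn // mulrA mulr_natl. Qed.

Lemma ler_log2 (R : realType) (y z : R) : 0 < y -> y <= z -> log2 y <= log2 z.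
Proof.
move=> y0 yz; rewrite /log2 ler_pM2r ?invr_gt0 ?ln2_gt0 // ler_ln ?posrE //.
exact: lt_le_trans yz.
Qed.

Lemma log2_2X (R : realType) (n : nat) : log2 (2 ^+ n : R) = n%:R.
Proof. by rewrite log2X // /log2 mulfV ?mulr1 // gt_eqF ?ln2_gt0. Qed.

Lemma log2_lt (R : realType) (n : nat) (z : R) : log2 z < n%:R -> z < 2 ^+ n.
Proof. by rewrite -(log2_2X R n); apply: contraTT; rewrite -!leNgt; apply: ler_log2; exact: exprn_gt0. Qed.

(** * Choice of the parameters and the depth bound *)

Theorem theorem3p1 (R : realType) :
  exists K : R, 0 < K /\
    forall (N d C : nat) (r delta : R) (x : 'I_N -> 'cV[R]_d) (y : 'I_N -> nat),
      (2 <= N)%N -> 1 <= r -> 0 < delta -> delta <= 1 ->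
      (forall i, (1 <= y i <= C)%N) ->
      (forall i, norm2 (x i) <= r) ->
      (forall i j, i != j -> delta <= norm2 (x i - x j)) ->
      let rho := 10 * r * N%:R ^+ 2 * delta^-1 * Num.sqrt (pi * d%:R) in
      exists F : relu_network R d,
        [/\ net_width F = 12%N,
            (net_depth F)%:R <=
              K * (Num.sqrt (N%:R * log2 N%:R) +
                   Num.sqrt (N%:R / log2 N%:R) *
                     Num.max (log2 rho) (log2 C%:R)) &
            forall i, net_eval F (x i) = (y i)%:R].
Proof.
(* 26 is [2 * 13]: below, [m <= 2 * s2] and [2 * l + 3 <= 13 * L]. The other terms,
   [2 * (N %/ m) + 3], are at most [5 * s1]. *)
exists 26; split=> // N d C r delta x y N2 r1 delta0 delta1 yC xr sep rho.
have N2R : 2 <= N%:R :> R by rewrite ler_nat.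
have d0 : (0 < d)%N.
  rewrite lt0n; apply/eqP => dE; subst d.
  have := sep (Ordinal (ltnW N2)) (Ordinal N2) isT.
  by rewrite /norm2 big_ord0 sqrtr0 leNgt delta0.
have dR : 1 <= d%:R :> R by rewrite ler1n.
have C0 : (0 < C)%N by have /andP[/leq_trans] := yC (Ordinal (ltnW N2)); exact.
have idelta : 1 <= delta^-1 by rewrite invf_ge1.
pose A := r * N%:R ^+ 2 * delta^-1.
have A1 : 1 <= A by rewrite mulr_ege1 // mulr_ege1 // exprn_ege1 //; lra.
have pid1 : d%:R <= pi * d%:R :> R.
  by rewrite ler_peMl //; have := pi_ge2 R; lra.
have rhoE : rho = 10 * A * Num.sqrt (pi * d%:R) by rewrite /rho /A !mulrA.
have sqrt1 : 1 <= Num.sqrt (pi * d%:R) :> R.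
  by rewrite -[X in X <= _]sqrtr1 ler_wsqrtr // (le_trans dR).
have rho2 : 2 <= rho.
  by rewrite rhoE; apply: (@le_trans _ _ (10 * A * 1)); [lra | rewrite ler_pM2l //; lra].
(* [rho] contains only the square root of [d], so a fourth power is taken to dominate [d ^ 2]; this
   costs a factor 4 in the bit length. *)
have rho4 : 8 * d%:R ^+ 2 * r * N%:R ^+ 2 / delta <= rho ^+ 4.
  have -> : rho ^+ 4 = 10 ^+ 4 * A ^+ 4 * (pi * d%:R) ^+ 2.
    rewrite rhoE !exprMn; congr (_ * _).
    by rewrite (exprM _ 2 2) sqr_sqrtr //; lra.
  have -> : 8 * d%:R ^+ 2 * r * N%:R ^+ 2 / delta = (8 * A) * d%:R ^+ 2.
    by rewrite /A; ring.
  apply: ler_pM; rewrite ?exprn_ge0 //; [lra | | by rewrite lerXn2r // nnegrE; lra].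
  have : A <= A ^+ 4 by rewrite ler_eXnr.
  have -> : (10 : R) ^+ 4 = 10000 by rewrite -natrX.
  lra.
pose L := Num.max (log2 rho) (log2 C%:R : R).
have rhoL : log2 rho <= L by rewrite le_max lexx.
have CL : log2 C%:R <= L by rewrite le_max lexx orbT.
have L1 : 1 <= L.
  apply: le_trans rhoL; rewrite -[X in X <= _](log2_2X R 1) expr1; exact: ler_log2.
(* Exceeds both [log2 (rho ^+ 4)] and [log2 C], so fingerprints and labels fit in [l] bits. *)
pose l := (Num.truncn (4 * L)).+1.
have lgt : 4 * L < l%:R by exact: truncnS_gt.
have lle : l%:R <= 5 * L.
  have : (Num.truncn (4 * L))%:R <= 4 * L by rewrite truncn_le; lra.
  by rewrite /l -natr1; lra.
pose lg : R := log2 N%:R.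
have lg1 : 1 <= lg by rewrite -[X in X <= _](log2_2X R 1) expr1; exact: ler_log2.
have lgN : lg <= N%:R.
  rewrite -(log2_2X R N); apply: ler_log2; first by lra.
  by rewrite -natrX ler_nat ltnW // ltn_expl.
pose s1 := Num.sqrt (N%:R * lg); pose s2 := Num.sqrt (N%:R / lg).
have s1_ge1 : 1 <= s1.
  by rewrite -[X in X <= _]sqrtr1 ler_wsqrtr // mulr_ege1 //; lra.
have s2_ge1 : 1 <= s2.
  by rewrite -[X in X <= _]sqrtr1 ler_wsqrtr // ler_pdivlMr ?mul1r //; lra.
have s12 : s1 * s2 = N%:R.
  rewrite -sqrtrM; last by rewrite mulr_ge0 //; lra.
  have -> : N%:R * lg * (N%:R / lg) = N%:R ^+ 2 by field; rewrite gt_eqF //; lra.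
  by rewrite sqrtr_sqr normr_nat.
(* As [s1 * s2 = N], groups of size about [s2] number at most about [s1], which matches the two
   terms of the bound. *)
pose m := (Num.truncn s2).+1.
have mgt : s2 < m%:R by exact: truncnS_gt.
have mle : m%:R <= 2 * s2.
  have : (Num.truncn s2)%:R <= s2 by rewrite truncn_le; lra.
  by rewrite /m -natr1; lra.
have Gle : (N %/ m)%:R <= s1.
  rewrite -(@ler_pM2r _ m%:R) ?ltr0n // -natrM.
  apply: (@le_trans _ _ N%:R); first by rewrite ler_nat leq_trunc_div.
  by rewrite -s12 ler_pM2l ?ltW //; lra.
have [u [b [ubd usep]]] := separating_projection delta0 xr sep.
pose t i := (u *m x i) 0 0 + b.
have t0 i : 0 <= t i by have /andP[] := ubd i.
have Ht : reach x 1 [:: t].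
  move: (reach_init x u b); congr (reach _ _ [:: _]); apply/funext => i.
  by rewrite max_r //; exact: t0.
have [|||||F [Fw Fd FE]] := @memorize_line R N d x t y C l m Ht t0.
- move=> i; have /andP[_ le] := ubd i.
  apply: (le_lt_trans le); apply: (le_lt_trans rho4); apply: log2_lt.
  by rewrite log2X; lra.
- by move=> i j /usep; rewrite /t opprD addrACA subrr addr0.
- by move=> i; have /andP[] := yC i.
- rewrite -(ltr_nat R) natrX; apply: log2_lt; lra.
- by [].
exists F; split=> //; rewrite Fd -/lg -/s1 -/s2 -/L.
rewrite !(natrD, natrM).
have H : m%:R * (2 * l%:R + 3) <= (2 * s2) * (2 * (5 * L) + 3 * L).
  by apply: ler_pM => //; lra.
have H' : 0 <= s2 * L by rewrite mulr_ge0 //; lra.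
lra.
Qed.
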